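(* Let $\mathcal M\subset\mathbb E$ be a $C^2$ embedded manifold, let $f:\mathbb E\to\mathbb R$ be differentiable, and let $\mathcal R:\mathcal D\subset\mathcal M\times\mathbb E\to\mathcal M$ be an ambient return map on $\mathcal M$. Assume there are constants $r,L>0$ such that, for every $x\in\mathcal M$ and every $u\in\mathbb E$ with $\|u\|\le r$, one has $(x,u)\in\mathcal D$ and $$f(\mathcal R_x(u))\le f(x)+\langle\nabla_{\mathcal M}f(x),u\rangle+\frac L2\|u\|_{\mathbb E}^2 .$$ Starting from $x_0\in\mathcal M$, generate $(x_t)_{t\ge 0}$ by $$s_t\in\mathrm{LMO}_{\|\cdot\|}(\nabla_{\mathcal M}f(x_t)),\qquad x_{t+1}:=\mathcal R_{x_t}(\alpha_t s_t),\qquad t=0,1,\ldots$$ Let $T\ge 1$. If $0<\alpha_t\le r$ for $t=0,\ldots,T-1$, then $$\sum_{t=0}^{T-1}\alpha_t\|\nabla_{\mathcal M}f(x_t)\|_*\le f(x_0)-f(x_T)+\frac{LN^2}{2}\sum_{t=0}^{T-1}\alpha_t^2 .$$ Moreover, suppose that $f$ is bounded below on $\mathcal M$, and let $\Delta_f\ge 0$ satisfy $\Delta_f\ge f(x_0)-\inf_{x\in\mathcal M}f(x)$. For $\alpha_t=\eta/\sqrt{t+1}$, $t=0,\ldots,T-1$, where $0<\eta\le r$, we have $$\min_{0\le t<T}\|\nabla_{\mathcal M}f(x_t)\|_*\le\frac{\Delta_f+\frac{LN^2\eta^2}{2}(1+\log T)}{\eta\sqrt T}=O\!\left(\frac{\log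 T}{\sqrt T}\right).$$
   Context: $\mathbb E$ is a (finite-dimensional) Euclidean space with inner product $\langle\cdot,\cdot\rangle$ and associated norm $\|\cdot\|_{\mathbb E}$. $\|\cdot\|$ is an arbitrary fixed norm on $\mathbb E$, with dual norm $\|g\|_*:=\sup_{\|s\|\le 1}\langle g,s\rangle$, and $N:=\sup_{\|z\|\le 1}\|z\|_{\mathbb E}<\infty$, so $\|z\|_{\mathbb E}\le N\|z\|$ for all $z$. Linear minimization oracle: $\mathrm{LMO}_{\|\cdot\|}(g):=\operatorname{argmin}_{\|s\|\le 1}\langle g,s\rangle$ (a set) for $g\in\mathbb E$. Embedded manifolds are without boundary. $T_x\mathcal M\subset\mathbb E$ is the tangent space, $P_{T_x\mathcal M}$ the Euclidean orthogonal projector onto it, and $\nabla_{\mathcal M}f(x):=P_{T_x\mathcal M}(\nabla f(x))$. Ambient return map. For $\mathcal M$ a $C^2$ embedded manifold and $x\in\mathcal M$, an ambient return map of $\mathcal M$ at $x$ is a $C^2$ map $\mathcal R_x:\mathcal D_x\to\mathcal M$, where $\mathcal D_x\subset\mathbb E$ is an open neighborhood of $0$, with $\mathcal R_x(0)=x$ and $D\mathcal R_x(0)=P_{T_x\mathcal M}$ (derivatives of manifold-valued maps are taken after viewing the maps as $\mathbb E$-valued). For $A\subset\mathcal M$, an ambient return map on $A$ is a $C^2$ map $\mathcal R:\mathcal D\to\mathcal M$, where $\mathcal D\subset\mathcal M\times\mathbb E$ is open and contains $A\times\{0\}$, such that for every $x\in A$ the fiber $\mathcal R_x:\mathcal D_x\to\mathcal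 M$, $\mathcal D_x:=\{u\in\mathbb E:(x,u)\in\mathcal D\}$, $\mathcal R_x(u):=\mathcal R(x,u)$, is an ambient return map of $\mathcal M$ at $x$. The $O(\cdot)$ is as $T\to\infty$ with all other quantities fixed. *)

(* Defs.v *)
From HB Require Import structures.
From mathcomp Require Import all_boot all_order all_algebra sesquilinear.
From mathcomp Require Import all_classical all_reals all_analysis.

Set Implicit Arguments.
Unset Strict Implicit.
Unset Printing Implicit Defensive.

Import Order.TTheory GRing.Theory Num.Theory.
Import numFieldNormedType.Exports.

Local Open Scope classical_set_scope.
Local Open Scope ring_scope.

(* The canonical norm `|x| of a Euclidean space, hence its topology, is the
   one induced by the inner product; [Vector] gives finite dimension. *)
HB.mixin Record isEuclidean (R : realType) (E : Type)
    of NormedModule R E & Vector R E := {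
  inner : {dot E for idfun};
  inner_normE : forall x : E, `|x| ^+ 2 = inner x x
}.

#[short(type="euclideanType")]
HB.structure Definition Euclidean (R : realType) :=
  { E of NormedModule R E & Vector R E & isEuclidean R E }.

Section Smoothness.
Context {R : realType}.

(* Only meant for open U. In finite dimension, the derivative x |-> 'd f x is
   C^k as a map into the space of linear maps iff x |-> 'd f x v is C^k for
   every vector v. *)
Fixpoint Ck_on (V W : normedModType R) (k : nat) (U : set V) (f : V -> W) :
    Prop :=
  if k is k'.+1 then
    (forall x, U x -> differentiable f x) /\
    (forall v : V, Ck_on k' U (fun x => 'd f x v))
  else forall x, U x -> {for x, continuous f}.

(* C^2 map on an arbitrary subset A (used for relatively open subsets of a
   product M x E): local extendability to C^2 maps on open sets. *)
Definition C2_map (V W : normedModType R) (A : set V) (f : V -> W) : Prop :=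
  forall p, A p -> exists (O : set V) (F : V -> W),
    [/\ open O, O p, Ck_on 2 O F & forall q, O q -> A q -> F q = f q].

Definition C2_diffeo (V W : normedModType R) (U : set V) (U' : set W)
    (phi : V -> W) : Prop :=
  [/\ open U, open U', set_bij U U' phi, Ck_on 2 U phi
    & exists psi : W -> V,
        Ck_on 2 U' psi /\ forall x, U x -> psi (phi x) = x].

End Smoothness.

Section Manifolds.
Context {R : realType} {E : euclideanType R}.

(* Local slice condition: near each of its points, M is straightened by an
   ambient C^2 diffeomorphism onto a piece of a d-dimensional subspace. *)
Definition embedded_C2_manifold (d : nat) (M : set E) : Prop :=
  forall x, M x -> exists (U V : set E) (phi : E -> E) (S : {vspace E}),
    [/\ U x, C2_diffeo U V phi, \dim S = d
      & phi @` (M `&` U) = V `&` [set y | y \in S]].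

(* Velocities at 0 of C^1 curves in M passing through x at time 0. *)
Definition tangent_space (M : set E) (x : E) : set E :=
  [set v | exists (e : R) (c : R^o -> E),
    [/\ 0 < e, Ck_on 1 `]-e, e[%classic c,
        (forall t, `]-e, e[%classic t -> M (c t)), c 0 = x
      & 'd c 0 1 = v]].

(* Uniquely determined when S is a linear subspace, as tangent spaces are. *)
Definition orth_proj (S : set E) (v : E) : E :=
  get [set w | S w /\ forall z, S z -> inner (v - w) z = 0].

(* Riesz representative of the differential. *)
Definition grad (f : E -> R) (x : E) : E :=
  get [set g | forall v, 'd (f : E -> R^o) x v = inner g v].

Definition rgrad (M : set E) (f : E -> R) (x : E) : E :=
  orth_proj (tangent_space M x) (grad f x).

Definition ambient_return_map_at (M : set E) (x : E) (D : set E)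
    (Rx : E -> E) : Prop :=
  [/\ open D /\ D 0, Ck_on 2 D Rx, (forall u, D u -> M (Rx u)), Rx 0 = x
    & forall v, 'd Rx 0 v = orth_proj (tangent_space M x) v].

(* [Rm] is a total function whose values outside the domain [D] are ignored. *)
Definition ambient_return_map (M A : set E) (D : set (E * E))
    (Rm : E * E -> E) : Prop :=
  [/\ exists O : set (E * E), open O /\ D = (M `*` setT) `&` O,
      A `*` [set 0] `<=` D,
      C2_map D Rm,
      forall p, D p -> M (Rm p)
    & forall x, A x ->
        ambient_return_map_at M x [set u | D (x, u)] (fun u => Rm (x, u))].

End Manifolds.

Section Norms.
Context {R : realType} {E : euclideanType R}.

Record is_norm (nu : E -> R) : Prop := IsNorm {
  is_norm_triangle : forall x y, nu (x + y) <= nu x + nu y;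
  is_norm_scale : forall (a : R) x, nu (a *: x) = `|a| * nu x;
  is_norm_definite : forall x, nu x = 0 -> x = 0
}.

Definition dual_norm (nu : E -> R) (g : E) : R :=
  sup [set inner g s | s in [set s | nu s <= 1]].

Definition norm_const (nu : E -> R) : R :=
  sup [set `|z| | z in [set z | nu z <= 1]].

Definition LMO (nu : E -> R) (g : E) : set E :=
  [set s | nu s <= 1 /\ forall s', nu s' <= 1 -> inner g s <= inner g s'].

End Norms.

(* Main.v *)
Require Import Defs.
From HB Require Import structures.
From mathcomp Require Import all_boot all_order all_algebra sesquilinear.
From mathcomp Require Import all_classical all_reals all_analysis.
From mathcomp Require Import ring lra.

Set Implicit Arguments.
Unset Strict Implicit.
Unset Printing Implicit Defensive.

Import Order.TTheory GRing.Theory Num.Theory.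
Import numFieldNormedType.Exports.

Local Open Scope classical_set_scope.
Local Open Scope ring_scope.

(** Why the theorem holds.  At a minimizer [s] of the linear form [inner g] on
    the unit ball of [nu] one has [inner g s = - dual_norm nu g]
    ([dual_norm_LMO]), and [s] has Euclidean norm at most [N]
    ([norm_le_norm_const]).  Inserting [u = alpha t *: s t] in the descent
    inequality therefore gives, with [G t] the dual norm of the Riemannian
    gradient at [x t],
      [f (x t.+1) <= f (x t) - alpha t * G t + L * N ^+ 2 / 2 * alpha t ^+ 2],
    and summing over [t < T] telescopes the values of [f]; this is the first
    claim.  The descent inequality may be used at each iterate because the
    iterates stay in [M] as long as the steps are at most [r].

    For [alpha t = eta / sqrt (t + 1)] the left side of the first claim is at
    least [eta * sqrt T] times the smallest [G t], since each of the [T] weights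
    is at least [eta / sqrt T], while on the right the squared steps add up to
    [eta ^+ 2] times a harmonic sum, which is at most [1 + ln T].  Dividing by
    [eta * sqrt T] gives the bound, and its order of growth is read off from
    [ln T >= ln 2 > 0] for [T >= 2].

    The one analytic ingredient is that [N] is finite.  As [norm_const] is the
    [sup] of a set of reals, it bounds that set only once the set is known to be
    bounded, that is, once the Euclidean norm is dominated by a multiple of
    [nu].  This is the equivalence of norms in finite dimension
    ([euclid_norm_le]): in coordinates [nu] is continuous, hence attains a
    positive minimum on the compact unit sphere of row vectors. *)

(** * Seminorms and equivalence of norms *)

Section Seminorms.
Context {R : realType} {V : lmodType R}.
Context (p : V -> R).
Context (pD : forall x y, p (x + y) <= p x + p y).
Context (pZ : forall (a : R) x, p (a *: x) = `|a| * p x).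

Lemma seminorm0 : p 0 = 0.
Proof. by rewrite -(scale0r 0) pZ normr0 mul0r. Qed.

Lemma seminormN x : p (- x) = p x.
Proof. by rewrite -scaleN1r pZ normrN1 mul1r. Qed.

Lemma seminorm_ge0 x : 0 <= p x.
Proof. by have := pD x (- x); rewrite subrr seminorm0 seminormN; lra. Qed.

Lemma seminorm_sum I (s : seq I) (F : I -> V) :
  p (\sum_(i <- s) F i) <= \sum_(i <- s) p (F i).
Proof.
elim/big_rec2 : _ => [|i y x _ h]; first by rewrite seminorm0.
by apply: le_trans (pD _ _) _; rewrite lerD2l.
Qed.

Lemma seminorm_dist x y : `|p x - p y| <= p (x - y).
Proof.
have h1 := pD (x - y) y; have h2 := pD (y - x) x.
rewrite !subrK in h1 h2; rewrite -(opprB x y) seminormN in h2.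
by rewrite ler_norml; lra.
Qed.
End Seminorms.

Section RowSeminorms.
Context {R : realType} {n : nat}.
Context (p : 'rV[R]_n -> R).
Context (pD : forall x y, p (x + y) <= p x + p y).
Context (pZ : forall (a : R) x, p (a *: x) = `|a| * p x).

Lemma coord_le_norm (v : 'rV[R]_n) i : `|v 0 i| <= `|v|.
Proof.
rewrite [leRHS]/Num.norm/= mx_normrE.
exact: (le_bigmax _ (fun ij : 'I_1 * 'I_n => `|v ij.1 ij.2|) (0, i)).
Qed.

(** Expanding [v] in the standard basis makes every seminorm Lipschitz. *)
Lemma seminorm_le_rV v : p v <= (\sum_i p (delta_mx 0 i)) * `|v|.
Proof.
rewrite {1}(row_sum_delta v) mulr_suml.
apply: le_trans (seminorm_sum pD pZ _ _) _.
apply: ler_sum => i _; rewrite pZ mulrC.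
by apply: ler_wpM2l (coord_le_norm _ _); exact: seminorm_ge0.
Qed.

Lemma seminorm_continuous : continuous p.
Proof.
move=> v; apply/(@cvgrPdist_le _ _ _ (nbhs v) (nbhs_filter v)) => e e0.
set K := \sum_i p (delta_mx 0 i).
(* [K] may vanish, so the radius is [e / (K + 1)]. *)
have K0 : 0 <= K by apply: sumr_ge0 => i _; exact: seminorm_ge0.
have K1 : 0 < K + 1 by lra.
apply/(@nbhs_normP R 'rV[R]_n v); exists (e / (K + 1)); first exact: divr_gt0.
move=> w /= /ltW vw.
apply: le_trans (seminorm_dist pD pZ _ _) _.
apply: le_trans (seminorm_le_rV _) _.
have : (K + 1) * `|v - w| <= e by rewrite mulrC -ler_pdivlMr.
have : 0 <= `|v - w| by [].
rewrite -/K; lra.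
Qed.

(** By homogeneity it suffices to bound [p] from below on the unit sphere, which
    is compact and on which [p] is continuous and vanishes nowhere. *)
Lemma norm_le_rV (p_definite : forall x, p x = 0 -> x = 0) :
  exists2 C, 0 <= C & forall v, `|v| <= C * p v.
Proof.
pose S := [set v : 'rV[R]_n | `|v| = 1].
have unitS v : v != 0 -> S (`|v|^-1 *: v).
  by move=> v0; rewrite /S/= normrZ normfV normr_id mulVf // normr_eq0.
(* The sphere is empty for [n = 0], when all vectors are null. *)
have [S0|/set0P S0] := eqVneq S set0.
  exists 0 => // v; rewrite mul0r normr_le0; apply/negPn/negP => /unitS.
  by rewrite S0.
have cS : compact S.
  apply: bounded_closed_compact.
    by exists 1; split => // M M1 v /= ->; exact: ltW.
  rewrite (_ : S = Num.norm @^-1` [set 1]) //.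
  by apply: closed_comp => [v _|]; [exact: norm_continuous|exact: closed_eq].
have [c /set_mem Sc cmin] :=
  EVT_min_rV S0 cS (continuous_subspaceT seminorm_continuous).
have pc : 0 < p c.
  rewrite lt_neqAle seminorm_ge0 // andbT eq_sym; apply/eqP => /p_definite c0.
  by move: Sc; rewrite /S/= c0 normr0 => /eqP; rewrite eq_sym oner_eq0.
exists (p c)^-1 => [|v]; first by rewrite invr_ge0 ltW.
have [->|v0] := eqVneq v 0.
  by rewrite normr0 mulr_ge0 // ?invr_ge0 ?seminorm_ge0 // ltW.
have := cmin _ (mem_set (unitS _ v0)).
rewrite pZ normfV normr_id mulrC ler_pdivlMr ?normr_gt0 // => h.
by rewrite mulrC ler_pdivlMr // mulrC.
Qed.
End RowSeminorms.

(** * The dual norm and the linear minimization oracle *)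

Section DualNorm.
Context {R : realType} {E : euclideanType R}.
Implicit Types (nu : E -> R) (g s z : E).

(** Equivalence of norms, transported from row vectors by the coordinates in a
    basis of [E]: both [nu] and the Euclidean norm become seminorms of rows. *)
Lemma euclid_norm_le nu : is_norm nu ->
  exists2 C, 0 <= C & forall z, `|z| <= C * nu z.
Proof.
case=> nuD nuZ nu0.
pose b := vbasis {:E}.
pose lc (v : 'rV[R]_(\dim {:E})) : E := \sum_i v 0 i *: b`_i.
have lcD v w : lc (v + w) = lc v + lc w.
  by rewrite -big_split; apply: eq_bigr => i _; rewrite mxE scalerDl.
have lcZ a v : lc (a *: v) = a *: lc v.
  by rewrite scaler_sumr; apply: eq_bigr => i _; rewrite mxE scalerA.
have lc0 v : lc v = 0 -> v = 0.
  move=> h; apply/rowP => i; rewrite mxE.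
  by have /freeP := basis_free (vbasisP {:E}); apply.
have [C C0 hC] : exists2 C, 0 <= C & forall v, `|v| <= C * nu (lc v).
  apply: norm_le_rV => [v w|a v|v /nu0/lc0 //]; first by rewrite lcD.
  by rewrite lcZ.
pose B := \sum_i `|lc (delta_mx 0 i)|.
have B0 : 0 <= B by apply: sumr_ge0.
have hB v : `|lc v| <= B * `|v|.
  apply: (seminorm_le_rV (p := fun v => `|lc v|)) => [u w|a u].
    by rewrite lcD ler_normD.
  by rewrite lcZ normrZ.
exists (B * C) => [|z]; first exact: mulr_ge0.
have -> : z = lc (\row_i coord b i z).
  rewrite {1}(coord_vbasis (memvf z)); apply: eq_bigr => i _.
  by rewrite mxE.
by apply: le_trans (hB _) _; rewrite -mulrA ler_wpM2l.
Qed.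

(** The set whose [sup] is [norm_const nu] is bounded by [euclid_norm_le]; a
    [sup] of an unbounded set of reals would be the junk value [0]. *)
Lemma norm_le_norm_const nu z : is_norm nu -> nu z <= 1 ->
  `|z| <= norm_const nu.
Proof.
move=> hnu z1; have [C C0 hC] := euclid_norm_le hnu.
apply: ub_le_sup; last by exists z.
exists C => _ [w /= w1 <-].
by apply: le_trans (hC w) _; rewrite ler_piMr.
Qed.

(** The unit ball of [nu] is symmetric, so the opposite of a minimizer of a
    linear form is a maximizer, and the [sup] is attained there. *)
Lemma dual_norm_LMO nu g s : is_norm nu -> LMO nu g s ->
  dual_norm nu g = - inner g s.
Proof.
move=> [nuD nuZ _] [s1 smin].
have nuN z : nu (- z) = nu z := seminormN nuZ z.
apply/eqP; rewrite eq_le; apply/andP; split.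
  apply: ge_sup; first by exists (inner g s), s.
  move=> _ [z /= z1 <-]; rewrite lerNr -linearNr.
  by apply: smin; rewrite nuN.
apply: ub_le_sup; last by exists (- s); rewrite /= ?nuN // linearNr.
exists (- inner g s) => _ [z /= z1 <-]; rewrite lerNr -linearNr.
by apply: smin; rewrite nuN.
Qed.

Lemma dual_norm_ge0 nu g s : is_norm nu -> LMO nu g s -> 0 <= dual_norm nu g.
Proof.
move=> hnu hs; rewrite (dual_norm_LMO hnu hs) oppr_ge0.
rewrite -[leRHS](linear0r inner g); apply: hs.2.
by rewrite (seminorm0 (is_norm_scale hnu)).
Qed.
End DualNorm.

(** * Sums and growth for the step sizes *)

Section StepSizeSums.
Context {R : realType}.

(** Each term [1 / (t + 1)] with [t > 0] is at most [ln (t + 1) - ln t], by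
    [ln (1 - u) <= - u] at [u = 1 / (t + 1)]; the term [t = 0] is the
    summand [1]. *)
Lemma sum_inv_le_ln (T : nat) : (1 <= T)%N ->
  \sum_(0 <= t < T) t.+1%:R^-1 <= 1 + ln T%:R :> R.
Proof.
case: T => // T _; elim: T => [|T IH].
  by rewrite big_nat1 invr1 ln1 addr0.
rewrite big_nat_recr //=; apply: le_trans (lerD IH (lexx _)) _.
rewrite -addrA lerD2l.
set a : R := T.+1%:R; set b : R := T.+2%:R.
have a0 : 0 < a by rewrite ltr0n.
have b0 : 0 < b by rewrite ltr0n.
have ba : b = a + 1 by rewrite /a /b -natr1.
have : ln (1 + - b^-1) <= - b^-1.
  by apply: le_ln1Dx; rewrite ltrN2 invf_lt1 // ba; lra.
have -> : 1 - b^-1 = a / b.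
  by rewrite -{1}(divff (lt0r_neq0 b0)) -[X in _ - X]mul1r -mulrBl ba addrK.
rewrite ln_div ?posrE // => h.
by rewrite -lerBrDr [leRHS]addrC -lerBlDr.
Qed.

(** All [T] terms are at least the last one, [1 / sqrt T]. *)
Lemma sum_invsqrt_ge (T : nat) :
  Num.sqrt T%:R <= \sum_(0 <= t < T) (Num.sqrt t.+1%:R)^-1 :> R.
Proof.
have [->|T0] := posnP T; first by rewrite sqrtr0 big_geq.
have sT0 : 0 < Num.sqrt T%:R :> R by rewrite sqrtr_gt0 ltr0n.
have -> : Num.sqrt T%:R = \sum_(0 <= t < T) (Num.sqrt T%:R)^-1 :> R.
  rewrite sumr_const_nat subn0 -[RHS]mulr_natr.
  have {3}-> : T%:R = Num.sqrt T%:R * Num.sqrt T%:R :> R.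
    by rewrite -expr2 sqr_sqrtr.
  by rewrite mulKf // gt_eqF.
rewrite !big_nat; apply: ler_sum => t /andP[_ tT].
by rewrite lef_pV2 ?posrE ?sqrtr_gt0 ?ltr0n // ler_wsqrtr // ler_nat.
Qed.

(** The constant term is absorbed since [1 <= ln T / ln 2] for [T >= 2]. *)
Lemma add_ln_bigO (a b c : R) : 0 < c ->
  (fun T : nat => (a + b * (1 + ln T%:R)) / (c * Num.sqrt T%:R) : R^o) =O_\oo
  (fun T : nat => ln T%:R / Num.sqrt T%:R : R^o).
Proof.
move=> c0; apply/eqO_exP => /=.
have l20 : 0 < ln 2 :> R by rewrite ln_gt0 // ltr1n.
pose K := ((`|a| + `|b|) / ln 2 + `|b|) / c.
have K0 : 0 <= K.
  by rewrite divr_ge0 ?addr_ge0 ?divr_ge0 ?addr_ge0 // ltW.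
(* The constant must be positive, while [K] vanishes for [a = b = 0]. *)
exists (K + 1); first by lra.
near=> T.
have T2 : (2 <= T)%N by near: T; exists 2%N.
have sT0 : 0 < Num.sqrt T%:R :> R.
  by rewrite sqrtr_gt0 ltr0n; apply: leq_trans T2.
have lT : ln 2 <= ln T%:R :> R.
  by rewrite ler_ln ?posrE ?ltr0n ?ler_nat //; apply: leq_trans T2.
have lT0 := lt_le_trans l20 lT.
have -> : `|ln T%:R / Num.sqrt T%:R : R^o| = ln T%:R / Num.sqrt T%:R.
  by rewrite ger0_norm // divr_ge0 // ltW.
have -> : `|(a + b * (1 + ln T%:R)) / (c * Num.sqrt T%:R) : R^o| =
    `|a + b * (1 + ln T%:R)| / (c * Num.sqrt T%:R).
  by rewrite normrM normfV (ger0_norm (mulr_ge0 (ltW c0) (ltW sT0))).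
rewrite invfM mulrA mulrA ler_pM2r ?invr_gt0 //.
apply: (@le_trans _ _ (K * ln T%:R)); last by rewrite ler_pM2r //; lra.
rewrite /K mulrAC ler_pM2r ?invr_gt0 //.
apply: le_trans (ler_normD _ _) _.
rewrite normrM (ger0_norm (_ : 0 <= 1 + ln T%:R)); last by lra.
rewrite mulrDl mulrAC mulrDr mulr1 addrA lerD2r.
by rewrite ler_pdivlMr // ler_wpM2l // addr_ge0.
Unshelve. all: by end_near. Qed.

Lemma bigmin_mul_sum (I : eqType) (l : seq I) (w y : I -> R) (y0 : R) :
  (forall i, 0 <= w i) ->
  \big[Num.min/y0]_(i <- l) y i * \sum_(i <- l) w i
    <= \sum_(i <- l) w i * y i.
Proof.
move=> w0; rewrite mulr_sumr [leLHS]big_seq [leRHS]big_seq.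
apply: ler_sum => i il; rewrite mulrC; apply: ler_wpM2l => //.
exact: ge_bigmin_seq.
Qed.
End StepSizeSums.

(** * Iterates and the descent of one step *)

Section Descent.
Context {R : realType} {E : euclideanType R}.

(** The step [alpha t *: s t] has [nu]-norm at most [alpha t <= r], so it
    lies in the fiber of [D] over [x t]. *)
Lemma iterates_in_manifold (nu : E -> R) (M : set E) (D : set (E * E))
    (Rm : E * E -> E) (r : R) (x s : nat -> E) (alpha : nat -> R) (T : nat) :
  is_norm nu ->
  (forall p, D p -> M (Rm p)) ->
  (forall y u, M y -> nu u <= r -> D (y, u)) ->
  (forall t, nu (s t) <= 1) ->
  (forall t, x t.+1 = Rm (x t, alpha t *: s t)) ->
  (forall t, (t < T)%N -> 0 < alpha t <= r) ->
  M (x 0%N) ->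
  forall t, (t <= T)%N -> M (x t).
Proof.
move=> [_ nuZ _] RmM hD s1 hx halpha M0; elim=> // t IH tT.
rewrite hx; apply/RmM/hD; first exact/IH/ltnW.
have /andP[a0 ar] := halpha _ tT.
rewrite nuZ gtr0_norm //; apply: le_trans ar.
by rewrite ler_piMr // ltW.
Qed.

(** The linear term of the descent inequality is [- a * dual_norm nu g], and the
    quadratic one is controlled by [|s| <= norm_const nu]. *)
Lemma LMO_step_descent (nu : E -> R) (g s : E) (f0 f1 L a : R) :
  is_norm nu -> LMO nu g s -> 0 < L -> 0 < a ->
  f1 <= f0 + inner g (a *: s) + L / 2 * `|a *: s| ^+ 2 ->
  a * dual_norm nu g <= f0 - f1 + L * norm_const nu ^+ 2 / 2 * a ^+ 2.
Proof.
move=> hnu hs L0 a0.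
rewrite (dual_norm_LMO hnu hs) linearZr /= normrZ gtr0_norm // => h.
have sN : `|s| ^+ 2 <= norm_const nu ^+ 2.
  have sN := norm_le_norm_const hnu hs.1.
  by rewrite ler_pXn2r ?nnegrE // (le_trans _ sN).
have : L / 2 * a ^+ 2 * `|s| ^+ 2 <= L / 2 * a ^+ 2 * norm_const nu ^+ 2.
  by rewrite ler_pM2l // mulr_gt0 ?exprn_gt0 // divr_gt0.
lra.
Qed.
End Descent.

Theorem theorem4p4 (R : realType) (E : euclideanType R)
    (nu : E -> R) (d : nat) (M : set E) (f : E -> R)
    (D : set (E * E)) (Rm : E * E -> E) (r L : R)
    (x s : nat -> E) (alpha : nat -> R)
    (hnu : is_norm nu)
    (hM : embedded_C2_manifold d M)
    (hf : forall y, differentiable (f : E -> R^o) y)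
    (hRm : ambient_return_map M M D Rm)
    (hr : 0 < r) (hL : 0 < L)
    (hdesc : forall y u, M y -> nu u <= r ->
       D (y, u) /\
       f (Rm (y, u)) <= f y + inner (rgrad M f y) u + L / 2 * `|u| ^+ 2)
    (hx0 : M (x 0%N))
    (hs : forall t, LMO nu (rgrad M f (x t)) (s t))
    (hx : forall t, x t.+1 = Rm (x t, alpha t *: s t)) :
  let N := norm_const nu in
  (forall T : nat, (1 <= T)%N ->
     (forall t, (t < T)%N -> 0 < alpha t <= r) ->
     \sum_(0 <= t < T) alpha t * dual_norm nu (rgrad M f (x t))
       <= f (x 0%N) - f (x T)
          + L * N ^+ 2 / 2 * \sum_(0 <= t < T) alpha t ^+ 2)
  /\
  (forall Delta eta : R,
     has_lbound (f @` M) ->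
     0 <= Delta -> f (x 0%N) - inf (f @` M) <= Delta ->
     0 < eta <= r ->
     let bound (T : nat) : R^o :=
       (Delta + L * N ^+ 2 * eta ^+ 2 / 2 * (1 + ln T%:R))
         / (eta * Num.sqrt T%:R) in
     (forall T : nat, (1 <= T)%N ->
        (forall t, (t < T)%N -> alpha t = eta / Num.sqrt t.+1%:R) ->
        \big[Num.min/dual_norm nu (rgrad M f (x 0%N))]_(0 <= t < T)
            dual_norm nu (rgrad M f (x t))
          <= bound T)
     /\ bound =O_\oo (fun T : nat => ln T%:R / Num.sqrt T%:R : R^o)).
Proof.
move=> N; have [_ _ _ RmM _] := hRm.
have stays T : (forall t, (t < T)%N -> 0 < alpha t <= r) ->
    forall t, (t <= T)%N -> M (x t).
  move=> halpha.
  apply: (iterates_in_manifold hnu RmM _ _ hx halpha hx0) => [y u|t].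
    by move=> My ur; case: (hdesc y u My ur).
  exact: (hs t).1.
have telescoped (T : nat) : (1 <= T)%N ->
     (forall t, (t < T)%N -> 0 < alpha t <= r) ->
     \sum_(0 <= t < T) alpha t * dual_norm nu (rgrad M f (x t))
       <= f (x 0%N) - f (x T)
          + L * N ^+ 2 / 2 * \sum_(0 <= t < T) alpha t ^+ 2.
  move=> _ halpha; have -> : f (x 0%N) - f (x T) =
      \sum_(0 <= t < T) (f (x t) - f (x t.+1)).
    rewrite -(opprB (f (x T))) -(telescope_sumr (fun t => f (x t))) // -sumrN.
    by apply: eq_bigr => t _; rewrite opprB.
  rewrite mulr_sumr -big_split /= !big_nat; apply: ler_sum => t /andP[_ tT].
  have /andP[a0 ar] := halpha _ tT.
  apply: (LMO_step_descent hnu (hs t) hL a0); rewrite hx.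
  apply: (hdesc _ _ _ _).2; first exact: stays halpha _ (ltnW tT).
  rewrite (is_norm_scale hnu) gtr0_norm //; apply: le_trans ar.
  by rewrite ler_piMr ?(hs t).1 // ltW.
split=> // Delta eta flb D0 hDelta /andP[eta0 etar] bound; split; last first.
  exact: add_ln_bigO.
move=> T T1 halpha.
have alpha_pos t : (t < T)%N -> 0 < alpha t <= r.
  move=> tT; rewrite halpha // divr_gt0 ?sqrtr_gt0 ?ltr0n //=.
  apply: le_trans etar; rewrite ler_pdivrMr ?sqrtr_gt0 ?ltr0n //.
  by rewrite ler_peMr ?(ltW eta0) // -[leLHS]sqrtr1 ler_wsqrtr // ler1n.
have sT0 : 0 < Num.sqrt T%:R :> R by rewrite sqrtr_gt0 ltr0n.
rewrite /bound ler_pdivlMr ?mulr_gt0 //.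
set m := \big[_/_]_(_ <= _ < _) _.
have y0 t : 0 <= dual_norm nu (rgrad M f (x t)) := dual_norm_ge0 hnu (hs t).
(* The sign of [m] allows replacing the sum of the weights [w], which multiplies
   [m], by its lower bound [sqrt T]. *)
have m0 : 0 <= m by exact: le_bigmin.
pose w (t : nat) : R := (Num.sqrt t.+1%:R)^-1.
have sum_alpha : \sum_(0 <= t < T) alpha t * dual_norm nu (rgrad M f (x t)) =
    eta * \sum_(0 <= t < T) w t * dual_norm nu (rgrad M f (x t)).
  rewrite mulr_sumr !big_nat; apply: eq_bigr => t /andP[_ tT].
  by rewrite halpha // mulrA.
have sum_alpha2 : \sum_(0 <= t < T) alpha t ^+ 2 =
    eta ^+ 2 * \sum_(0 <= t < T) t.+1%:R^-1.
  rewrite mulr_sumr !big_nat; apply: eq_bigr => t /andP[_ tT].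
  by rewrite halpha // exprMn exprVn sqr_sqrtr // ler0n.
have fT : inf (f @` M) <= f (x T).
  apply: ge_inf => //; exists (x T) => //.
  exact: stays alpha_pos _ (leqnn T).
have := telescoped _ T1 alpha_pos; rewrite sum_alpha sum_alpha2 => main.
have lower : eta * (m * Num.sqrt T%:R) <=
    eta * \sum_(0 <= t < T) w t * dual_norm nu (rgrad M f (x t)).
  rewrite ler_pM2l //; apply: le_trans (bigmin_mul_sum _ _ _ _); last first.
    by move=> t; rewrite invr_ge0 sqrtr_ge0.
  by apply: ler_wpM2l => //; exact: sum_invsqrt_ge.
have upper : L * N ^+ 2 / 2 * (eta ^+ 2 * \sum_(0 <= t < T) t.+1%:R^-1) <=
    L * N ^+ 2 * eta ^+ 2 / 2 * (1 + ln T%:R).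
  rewrite mulrA [X in X * _](_ : _ = L * N ^+ 2 * eta ^+ 2 / 2); last by ring.
  apply: ler_wpM2l (sum_inv_le_ln T1).
  by rewrite divr_ge0 // mulr_ge0 ?sqr_ge0 // mulr_ge0 ?sqr_ge0 // ltW.
rewrite mulrCA; lra.
Qed.
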